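(* Let $M\ge2$ be an integer, $n\in\mathbb{N}$ and $\beta\in(1,\beta_n)$. Let $D\subseteq\{0,\ldots,M\}$ be such that $\#D\ge2$, write $D^c=\{0,\ldots,M\}\setminus D$, and let $(p_k)_{k\in D^c}$ be real numbers such that $0\le p_k\le\frac{n}{n+1}$ for all $k\in D^c$ and $\sum_{k\in D^c}p_k<1$. Then for any $x\in\big(0,\frac{M}{\beta-1}\big)$ there exists $(a_i)\in\Sigma_{\beta,M}(x)$ such that $\mathrm{freq}_k(a_i)$ does not exist for every $k\in D$, while $\mathrm{freq}_k(a_i)$ exists and equals $p_k$ for every $k\in D^c$.
   Context: $\mathbb{N}=\{1,2,3,\ldots\}$. For $n\in\mathbb{N}$, $\beta_n$ denotes the unique zero of $f_n(x)=x^{n+1}-x^n-1$ in the interval $(1,2)$. For $\beta\in(1,M+1]$ and $x\in[0,\frac{M}{\beta-1}]$, $\Sigma_{\beta,M}(x)=\{(a_i)_{i\ge1}\in\{0,\ldots,M\}^{\mathbb{N}}:\sum_{i=1}^{\infty}\frac{a_i}{\beta^i}=x\}$. For $(a_i)\in\{0,\ldots,M\}^{\mathbb{N}}$ and $k\in\{0,\ldots,M\}$, $\mathrm{freq}_k(a_i)=\lim_{N\to\infty}\frac{\#\{1\le i\le N:a_i=k\}}{N}$; it is said not to exist when this limit does not exist. An empty sum equals $0$. *)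

(* Defs.v *)
From HB Require Import structures.
From mathcomp Require Import all_boot all_order all_algebra.
From mathcomp Require Import all_classical all_reals all_analysis.

Set Implicit Arguments.
Unset Strict Implicit.
Unset Printing Implicit Defensive.

Import Order.TTheory GRing.Theory Num.Theory.
Import numFieldNormedType.Exports.

Local Open Scope classical_set_scope.
Local Open Scope ring_scope.

Definition fn {R : realType} (n : nat) (x : R) : R := x ^+ n.+1 - x ^+ n - 1.

(* [xget] only provides a total function; for [0 < n] the zero exists and is
   unique, see [betan_spec] and [betan_unique] below. *)
Definition betan (R : realType) (n : nat) : R :=
  xget 0 [set x : R | 1 < x < 2 /\ fn n x = 0].

Lemma fn_inj (R : realType) (n : nat) (x y : R) :
  1 < x -> 1 < y -> fn n x = 0 -> fn n y = 0 -> x = y.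
Proof.
suff lt_fn (a b : R) : 1 < a -> a < b -> fn n a < fn n b.
  move=> x1 y1 fx fy; case: (ltgtP x y) => // xy.
    by have := lt_fn _ _ x1 xy; rewrite fx fy ltxx.
  by have := lt_fn _ _ y1 xy; rewrite fx fy ltxx.
move=> a1 ab; have a0 : 0 < a by apply: lt_trans a1.
have fE (z : R) : fn n z = z ^+ n * (z - 1) - 1.
  by rewrite /fn mulrBr mulr1 -exprSr.
rewrite !fE ltrD2r.
apply: (@le_lt_trans _ _ (b ^+ n * (a - 1))).
  rewrite ler_wpM2r ?subr_ge0; [by []|exact: ltW|].
  by apply: lerXn2r; rewrite ?nnegrE ltW // (lt_trans a0).
by rewrite ltr_pM2l ?ltrD2r // exprn_gt0 // (lt_trans a0).
Qed.

Lemma fn_zero_exists (R : realType) (n : nat) :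
  (0 < n)%N -> exists x : R, 1 < x < 2 /\ fn n x = 0.
Proof.
move=> n0; pose q : {poly R} := 'X^(n.+1) - 'X^n - 1.
have qE (z : R) : q.[z] = fn n z by rewrite /q /fn !hornerE.
have f1 : fn n (1 : R) = -1 by rewrite /fn !expr1n subrr sub0r.
have f2 : 0 < fn n (2 : R).
  rewrite /fn exprS mulr_natl mulr2n addrK subr_gt0.
  by rewrite exprn_egt1 // ?ltr1n // -lt0n.
have [||x /andP[x1 x2] /rootP qx] := @poly_ivt R q 1 2.
- by rewrite ler1n.
- by rewrite !qE f1 lerN10 ltW.
exists x; split; last by rewrite -qE.
rewrite !lt_neqAle x1 x2 !andbT; apply/andP; split; apply/eqP => xE.
  by move/eqP: qx; rewrite qE -xE f1 oppr_eq0 oner_eq0.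
by move: f2; rewrite -xE -qE qx ltxx.
Qed.

Lemma betan_spec (R : realType) (n : nat) :
  (0 < n)%N -> 1 < betan R n < 2 /\ fn n (betan R n) = 0.
Proof.
move=> /(fn_zero_exists R)[x Px].
exact: (@xgetI _ 0 [set y : R | 1 < y < 2 /\ fn n y = 0] x Px).
Qed.

Lemma betan_unique (R : realType) (n : nat) (x : R) :
  (0 < n)%N -> 1 < x < 2 -> fn n x = 0 -> x = betan R n.
Proof.
move=> n0 /andP[x1 _] fx; have [/andP[b1 _] fb] := betan_spec R n0.
exact: fn_inj fx fb.
Qed.

(* A digit sequence (a_i)_{i >= 1} is encoded with a shift: [a i] is the digit
   written a_(i+1), so [a 0] is the first digit. *)
Definition digit_seq (M : nat) := nat -> 'I_M.+1.

Definition Sigma {R : realType} (beta : R) (M : nat) (x : R) :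
    set (digit_seq M) :=
  [set a | series (fun i => (a i)%:R / beta ^+ i.+1) @ \oo --> x].

Definition freq_upto (R : realType) (M : nat) (a : digit_seq M) (k : 'I_M.+1)
    (N : nat) : R :=
  #|[pred i : 'I_N | a i == k]|%:R / N%:R.

Definition freq_is {R : realType} (M : nat) (a : digit_seq M) (k : 'I_M.+1)
    (l : R) : Prop :=
  freq_upto R a k @ \oo --> l.

Definition freq_exists (R : realType) (M : nat) (a : digit_seq M)
    (k : 'I_M.+1) : Prop :=
  exists l : R, freq_is a k l.

(* Main.v *)
Require Import Defs.
From HB Require Import structures.
From mathcomp Require Import all_boot all_order all_algebra.
From mathcomp Require Import all_classical all_reals all_analysis.
From mathcomp Require Import zify ring lra.

Set Implicit Arguments.
Unset Strict Implicit.
Unset Printing Implicit Defensive.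

Import Order.TTheory GRing.Theory Num.Theory.
Import numFieldNormedType.Exports.

Local Open Scope classical_set_scope.
Local Open Scope ring_scope.

(** Reading digits is steering a point: the digit d moves the current remainder
    y to beta * y - d, and any digit sequence that brings the remainder back to
    a bounded nonnegative range infinitely often is an expansion of x
    (Sigma_of_bounded_remainders).  So the theorem asks for a control of this
    expanding dynamics with prescribed frequencies of the controls.

    Write F = 1 / (beta - 1), so that the digit d fixes the point d * F, and let
    j, k be two distinct digits.  In the coordinate z = (y - j * F) / (k - j)
    the digit j acts as z -> beta * z and the digit k as z -> beta * z - 1,
    whatever j and k are.  The interval from tau to 1 + tau is preserved by the
    policy that reads j while beta * z <= 1 + tau and k otherwise.  On it, k
    multiplies z by at most rho = beta - 1 + tau.  As beta < beta_n means
    beta ^ n * (beta - 1) < 1, some tau > 0 gives rho * beta ^ n < 1, with a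
    strict margin.  Since z stays between two positive constants, each k is paid
    for by more than n occurrences of j on average: the frequency of j is at
    least some c > n / (n + 1), all other letters being k (pair_policy,
    exponent_balance).  From a compact part of the open interval from 0 to
    M * F, every such policy can be entered in bounded time, because a target
    interval of length 1 is always reachable (reach_unit_intervals).  Hence, up
    to bounded errors, a frequency of at least c for j and the rest for k can be
    produced at any moment, for every ordered pair (steering).

    The vectors with entries c at j and 1 - c at k are the vertices of the
    polytope of probability vectors with entries at most c (as c >= 1/2).  A target sequence v with values in this
    polytope is followed by a greedy rule: at stage s, let j and k be the letters
    with the smallest and second smallest discrepancy between achieved and
    targeted counts, and steer with (j, k) for about s letters.  A linear form is
    minimal on the polytope at a vertex, so the scalar product of discrepancy
    and drift is at most a constant times the largest discrepancy
    (greedy_drift), which is at most the number N of letters read so far.  As N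
    grows like s ^ 2, so does the increment of the sum of the squares of the
    discrepancies, and this sum is O(s ^ 3), much less than N ^ 2.  Thus the
    discrepancies are o(N) (steered_discrepancy).

    It remains to choose v: equal to p outside D, and on D oscillating between
    two vectors which differ in every entry, along blocks of dyadic length.
    Averages along such blocks do not converge (oscillating_target,
    dyadic_blocks_no_average).  The strict inequality c > 1/2 leaves room for
    the oscillation even if D has two elements which share the whole mass and
    n = 1. *)

(** * Digit sequences as orbits *)

Lemma expr_unbounded (R : realType) (b C : R) : 1 < b ->
  exists K : nat, C <= b ^+ K.
Proof.
move=> b1; have b0 : 0 < b - 1 by rewrite subr_gt0.
have bernoulli K : 1 + (b - 1) * K%:R <= b ^+ K.
  elim: K => [|K IHK]; first by rewrite mulr0 addr0 expr0.
  rewrite exprS -natr1.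
  have : b * (1 + (b - 1) * K%:R) <= b * b ^+ K by rewrite ler_wpM2l //; lra.
  have : (0 : R) <= (b - 1) * ((b - 1) * K%:R).
    by rewrite mulr_ge0 ?mulr_ge0 // ltW.
  lra.
exists (Num.bound (C / (b - 1))); apply: le_trans (bernoulli _).
have : C / (b - 1) < (Num.bound (C / (b - 1)))%:R by exact: unstable.ltr_bound.
by rewrite ltr_pdivrMr //; lra.
Qed.

(** What is left of x after the digits w, rescaled by beta ^ size w. *)
Definition remainder {R : realType} (M : nat) (beta x : R)
    (w : seq 'I_M.+1) : R :=
  foldl (fun y (d : 'I_M.+1) => beta * y - d%:R) x w.

Lemma remainder_cat (R : realType) (M : nat) (beta x : R)
    (w1 w2 : seq 'I_M.+1) :
  remainder beta x (w1 ++ w2) = remainder beta (remainder beta x w1) w2.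
Proof. exact: foldl_cat. Qed.

Lemma remainder_mkseq (R : realType) (M : nat) (beta x : R)
    (a : digit_seq M) (N : nat) : beta != 0 ->
  remainder beta x (mkseq a N)
    = beta ^+ N * (x - series (fun i => (a i)%:R / beta ^+ i.+1) N).
Proof.
move=> b0; elim: N => [|N IHN].
  by rewrite /series /= big_geq // expr0 mul1r subr0.
rewrite mkseqS -cats1 remainder_cat IHN.
rewrite /series /= big_nat_recr //= /remainder /= !exprS.
have := expf_neq0 N b0 => bN0.
by field; rewrite b0 bN0.
Qed.

(** The partial sums increase, so it is enough to control them along a
    subsequence, where the error is a bounded remainder over beta ^ N. *)
Lemma Sigma_of_bounded_remainders (R : realType) (M : nat) (beta x B : R)
    (a : digit_seq M) : 1 < beta ->
  (forall n, exists2 N, (n <= N)%N & 0 <= remainder beta x (mkseq a N) <= B) ->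
  Sigma beta x a.
Proof.
move=> b1 Hrec; have b0 : 0 < beta by apply: lt_trans b1.
have bX N : 0 < beta ^+ N by rewrite exprn_gt0.
rewrite /Sigma /=; set S := series _.
have Smono : {homo S : m n / (m <= n)%N >-> m <= n}.
  apply/nondecreasing_seqP => N; rewrite /S /series /= big_nat_recr //= lerDl.
  by rewrite divr_ge0 // ltW.
have rE N : remainder beta x (mkseq a N) = beta ^+ N * (x - S N).
  by apply: remainder_mkseq; rewrite gt_eqF.
have Sle N : S N <= x.
  have [N' leN /andP[+ _]] := Hrec N; rewrite rE pmulr_rge0 // subr_ge0.
  exact/le_trans/Smono.
apply/cvgrPdist_le => /= e e0.
have [K] := expr_unbounded (B / e) b1; rewrite ler_pdivrMr // => hK.
have [N0 leK /andP[_]] := Hrec K; rewrite rE => hN0.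
exists N0 => // N /= leN; rewrite ger0_norm ?subr_ge0 //.
apply: (@le_trans _ _ (x - S N0)); first by rewrite lerB // Smono.
rewrite -(ler_pM2l (bX N0)); apply: (le_trans hN0); apply: (le_trans hK).
by rewrite ler_pM2r // ler_weXn2l // ltW.
Qed.

(** * Reaching intervals of length one *)

(** The translates by the digits of an interval of length 1 tile a whole
    interval. *)
Lemma digit_into_unit_interval (R : realType) (M : nat) (y g : R) :
  g <= y -> y <= g + 1 + M%:R ->
  exists a : 'I_M.+1, g <= y - a%:R <= g + 1.
Proof.
move=> gy yM; have yg0 : 0 <= y - g by rewrite subr_ge0.
have /andP[] := truncn_itv yg0; set m := Num.trunc _; rewrite -natr1 => m1 m2.
have [mM|Mm] := leqP m M.
  by exists (inord m); rewrite inordK //; apply/andP; split; lra.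
(* The floor exceeds M only at the right end, where the digit M still works. *)
exists ord_max => /=; have : M.+1%:R <= m%:R :> R by rewrite ler_nat.
by rewrite -natr1 => ?; apply/andP; split; lra.
Qed.

(** Below the target, the digit 0 multiplies the distance to 0 by beta until the
    next step can be made to land in the target. *)
Lemma climb_into_unit_interval (R : realType) (M : nat) (beta g x : R)
    (t : nat) : 1 < beta -> g * (beta - 1) <= M%:R ->
  0 <= x -> x <= g -> g <= beta ^+ t * x ->
  exists2 w : seq 'I_M.+1,
    (size w <= t.+1)%N & g <= remainder beta x w <= g + 1.
Proof.
move=> b1 gM; elim: t x => [|t IHt] x x0 xg hx.
all: have [gbx|bxg] := lerP g (beta * x).
1,3: have [||a ha] := @digit_into_unit_interval R M (beta * x) g => //;
  [nra | by exists [:: a]].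
  by rewrite expr0 mul1r in hx; nra.
have [||| w sw hw] := IHt (beta * x).
- by rewrite mulr_ge0 // ltW // (lt_trans ltr01).
- exact: ltW.
- by rewrite mulrA -exprSr.
by exists (ord0 :: w); rewrite /remainder //= subr0.
Qed.

(** The mirror image: above the target, the digit M multiplies the distance to
    the right end point by beta. *)
Lemma descend_into_unit_interval (R : realType) (M : nat) (beta g x : R)
    (t : nat) : 1 < beta -> 0 <= g -> g + 1 <= x -> x * (beta - 1) <= M%:R ->
  M%:R / (beta - 1) <= beta ^+ t * (M%:R / (beta - 1) - x) + g + 1 ->
  exists2 w : seq 'I_M.+1,
    (size w <= t.+1)%N & g <= remainder beta x w <= g + 1.
Proof.
set F := M%:R / (beta - 1) => b1 g0.
have b10 : 0 < beta - 1 by rewrite subr_gt0.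
have FE : F * (beta - 1) = M%:R by rewrite /F divfK // gt_eqF.
elim: t x => [|t IHt] x gx xM hx.
all: have [bxg|gbx] := lerP (beta * x) (g + 1 + M%:R).
1,3: have [||a ha] := @digit_into_unit_interval R M (beta * x) g => //;
  [nra | by exists [:: a]].
  by rewrite expr0 mul1r in hx; nra.
have [||| w sw hw] := IHt (beta * x - M%:R).
- by lra.
- have : x <= F by rewrite /F ler_pdivlMr.
  nra.
- apply: (le_trans hx); rewrite exprSr -!mulrA.
  by have -> : beta * (F - x) = F - (beta * x - M%:R) by rewrite -FE; ring.
by exists (ord_max :: w).
Qed.

(** The time is uniform because the distance to either end point, at least kappa
    at the start, grows geometrically. *)
Lemma reach_unit_intervals (R : realType) (M : nat) (beta kappa : R) :
  1 < beta -> 0 < kappa ->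
  exists T : nat, forall x g : R,
    kappa <= x <= M%:R / (beta - 1) - kappa ->
    0 <= g -> g + 1 <= M%:R / (beta - 1) ->
    exists2 w : seq 'I_M.+1,
      (size w <= T)%N & g <= remainder beta x w <= g + 1.
Proof.
set F := M%:R / (beta - 1) => b1 k0.
have [t ht] := expr_unbounded (F / kappa) b1.
rewrite ler_pdivrMr // in ht.
exists t.+1 => x g /andP[kx xk] g0 gF.
have b10 : 0 < beta - 1 by rewrite subr_gt0.
have t1 : 0 <= beta ^+ t by rewrite exprn_ge0 // ltW // (lt_trans ltr01).
have [xg|gx] := lerP x g.
  apply: climb_into_unit_interval => //.
  - by rewrite -ler_pdivlMr // -/F; lra.
  - by lra.
  - by have := ler_wpM2l t1 kx; lra.
have [xg|gx1] := lerP x (g + 1); first by exists [::] => //=; rewrite ltW.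
apply: descend_into_unit_interval => //; first exact: ltW.
  by rewrite -ler_pdivlMr // -/F; lra.
have : kappa <= F - x by lra.
by rewrite -/F; move/(ler_wpM2l t1); lra.
Qed.

(** * Expansions with two digits *)

(** The policy described at the beginning, in the coordinate z in which the roles
    of j < k and k < j are the same.  The bound on z' records that j multiplies z
    by beta and that k multiplies it by at most beta - 1 + tau. *)
Lemma pair_policy (R : realType) (M : nat) (beta tau : R) (j k : 'I_M.+1) :
  1 < beta -> 0 < tau -> beta - 1 + tau <= 1 -> (beta - 1) * (1 + tau) <= 1 ->
  j != k -> forall (s : nat) (z : R), tau <= z <= 1 + tau ->
  exists2 w : seq 'I_M.+1,
    size w = s /\ (count_mem j w + count_mem k w = s)%N
  & exists2 z' : R, tau <= z' <= 1 + tau /\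
      z' <= z * beta ^+ count_mem j w * (beta - 1 + tau) ^+ count_mem k w
    & remainder beta (j%:R / (beta - 1) + (k%:R - j%:R) * z) w
        = j%:R / (beta - 1) + (k%:R - j%:R) * z'.
Proof.
move=> b1 tau0 rho1 btau jk; have b10 : 0 < beta - 1 by rewrite subr_gt0.
elim=> [|s IHs] z /andP[z1 z2].
  by exists [::] => //; exists z; rewrite ?z1 ?z2 // !expr0 !mulr1.
have kj : (k == j) = false by rewrite eq_sym (negbTE jk).
have [zs|zl] := lerP (beta * z) (1 + tau).
  have [|w [sw cw] [z' [hz' lez'] Ez']] := IHs (beta * z).
    rewrite zs andbT; apply: (le_trans z1); rewrite ler_peMl ?(ltW b1) //.
    exact/ltW/(lt_le_trans tau0).
  exists (j :: w).
    by rewrite /= eqxx (negbTE jk) sw add0n add1n addSn cw.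
  exists z'; first split=> //.
    by rewrite /= eqxx (negbTE jk) exprSr add0n; apply: le_trans lez' _; lra.
  rewrite -Ez' /remainder /=; congr foldl.
  by field; rewrite gt_eqF.
have zrho : beta * z - 1 <= z * (beta - 1 + tau).
  have tau1 : 0 <= 1 - tau by lra.
  by have := ler_wpM2l tau1 z2; have := sqr_ge0 tau; rewrite expr2; lra.
have [|w [sw cw] [z' [hz' lez'] Ez']] := IHs (beta * z - 1).
  have bz2 := ler_wpM2l (ltW (lt_trans ltr01 b1)) z2.
  by apply/andP; split; lra.
exists (k :: w).
  by rewrite /= eqxx kj sw add0n add1n addnS cw.
exists z'; first split=> //.
  rewrite /= eqxx kj add0n exprS; apply: le_trans lez' _.
  rewrite mulrCA [in leRHS]mulrA -!mulrA [leRHS]mulrA ler_wpM2r //; last lra.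
  by rewrite mulr_ge0 // exprn_ge0 //; lra.
rewrite -Ez' /remainder /=; congr foldl.
by field; rewrite gt_eqF.
Qed.

(** If beta ^ J * rho ^ K is bounded below, then the number K of contractions is
    limited by the number J of expansions.  The integer Q quantifies the margin in
    rho * beta ^ n < 1: it turns the ratio n of J to K into n + 1 / Q. *)
Lemma exponent_balance (R : realType) (beta rho A : R) (n Q T J K : nat) :
  1 < beta -> 0 < rho -> beta <= (rho * beta ^+ n)^-1 ^+ Q ->
  0 <= A -> A ^+ Q <= beta ^+ T -> 1 <= A * (beta ^+ J * rho ^+ K) ->
  ((n * Q + 1) * K <= J * Q + T)%N.
Proof.
move=> b1 rho0 hQ A0 hT hA; have b0 : 0 < beta by apply: lt_trans b1.
rewrite -(ler_eXn2l b1).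
have X0 : 0 <= (beta ^+ J * rho ^+ K) ^+ Q.
  by rewrite exprn_ge0 // mulr_ge0 // exprn_ge0 // ltW.
have h1 : 1 <= beta ^+ T * (beta ^+ J * rho ^+ K) ^+ Q.
  apply: (@le_trans _ _ ((A * (beta ^+ J * rho ^+ K)) ^+ Q)).
    exact: exprn_ege1.
  by rewrite exprMn ler_wpM2r.
have s0 : 0 < rho * beta ^+ n by rewrite mulr_gt0 // exprn_gt0.
have h2 : ((rho * beta ^+ n) ^+ Q * beta) ^+ K <= 1.
  apply: exprn_ile1; first by rewrite mulr_ge0 ?exprn_ge0 // ltW.
  apply: le_trans (ler_wpM2l (exprn_ge0 Q (ltW s0)) hQ) _.
  by rewrite -exprMn divff ?gt_eqF // expr1n.
have B0 : 0 <= beta ^+ ((n * Q + 1) * K) by rewrite exprn_ge0 // ltW.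
apply: (le_trans (ler_peMr B0 h1)).
apply: le_trans (ler_piMr (exprn_ge0 _ (ltW b0)) h2).
rewrite le_eqVlt; apply/orP; left; apply/eqP.
rewrite mulnDl mul1n !exprD !exprMn -!exprM.
by rewrite [(K * Q)%N]mulnC -mulnA; ring.
Qed.

(** The equation of beta_n reads beta_n ^ n * (beta_n - 1) = 1, and the left side
    increases with the base. *)
Lemma betan_slack (R : realType) (n : nat) (beta : R) : (1 <= n)%N ->
  1 < beta -> beta < betan R n -> beta ^+ n * (beta - 1) < 1.
Proof.
move=> n1 b1 bb; have [_ fb] := betan_spec R n1.
have bE : betan R n ^+ n * (betan R n - 1) = 1.
  by move: fb; rewrite /fn exprSr => ?; lra.
have b0 : 0 < beta by apply: lt_trans b1.
rewrite -[ltRHS]bE; apply: (@lt_le_trans _ _ (beta ^+ n * (betan R n - 1))).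
  by rewrite ltr_pM2l ?exprn_gt0 // ltrD2r.
rewrite ler_wpM2r //; first by lra.
by rewrite lerXn2r ?nnegrE ?ltW // (lt_trans b0).
Qed.

(** The margin left by beta < beta_n, as a thickening tau for which all the
    estimates of the two-digit policy hold. *)
Lemma escape_margin (R : realType) (beta : R) (n : nat) :
  1 < beta -> beta ^+ n * (beta - 1) < 1 ->
  exists tau : R, [/\ 0 < tau, beta - 1 + tau <= 1, (beta - 1) * (1 + tau) < 1
    & (beta - 1 + tau) * beta ^+ n < 1].
Proof.
move=> b1 hb; have bn1 : 1 <= beta ^+ n by rewrite exprn_ege1 // ltW.
have bn0 : 0 < beta ^+ n by apply: lt_le_trans bn1.
have hu : beta - 1 < (beta ^+ n)^-1.
  by rewrite -[_^-1]div1r ltr_pdivlMr // mulrC.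
have u1 : (beta ^+ n)^-1 <= 1 by rewrite invf_le1.
set u := _^-1 in hu u1; have uE : u * beta ^+ n = 1.
  by rewrite mulVf // gt_eqF.
pose tau := (u - (beta - 1)) / 2.
have tau0 : 0 < tau by rewrite /tau; lra.
have rhou : beta - 1 + tau < u by rewrite /tau; lra.
exists tau; split=> //.
- exact: le_trans (ltW rhou) u1.
- have b11 : beta - 1 <= 1 by lra.
  by have := ler_wpM2r (ltW tau0) b11; lra.
- by rewrite -[ltRHS]uE ltr_pM2r.
Qed.

(** The interface between the dynamics and the counting: from the compact
    interval cut off by kappa, the letter j can be given a frequency at least c
    and {j, k} almost all the mass, up to an error T independent of the starting
    point and of the duration, with a return to the same interval.  The strict
    inequality n / (n + 1) < c is the gain from the margin. *)
Lemma steering (R : realType) (M n : nat) (beta x : R) :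
  1 < beta -> beta ^+ n * (beta - 1) < 1 -> 0 < x < M%:R / (beta - 1) ->
  exists c : R, exists kappa : R, exists T : nat,
  [/\ n%:R / n.+1%:R < c, c <= 1,
      kappa <= x <= M%:R / (beta - 1) - kappa /\ 0 < kappa
    & forall (y : R) (j k : 'I_M.+1) (s : nat),
      kappa <= y <= M%:R / (beta - 1) - kappa -> j != k ->
      exists w : seq 'I_M.+1,
      [/\ kappa <= remainder beta y w <= M%:R / (beta - 1) - kappa,
          (s <= size w <= s + T)%N,
          c * (size w)%:R - T%:R <= (count_mem j w)%:R
        & (size w)%:R - T%:R <= (count_mem j w)%:R + (count_mem k w)%:R :> R]].
Proof.
move=> b1 hb /andP[x0 xF]; have b10 : 0 < beta - 1 by rewrite subr_gt0.
have [tau [tau0 rho1 btau rhobn]] := escape_margin b1 hb.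
pose F := (beta - 1)^-1; have F0 : 0 < F by rewrite invr_gt0.
have Ftau : 1 + tau < F by rewrite /F -[_^-1]div1r ltr_pdivlMr // mulrC.
have rho0 : 0 < beta - 1 + tau by rewrite addr_gt0.
have s0 : 0 < (beta - 1 + tau) * beta ^+ n.
  by rewrite mulr_gt0 // exprn_gt0 // (lt_trans ltr01).
have [Q hQ] : exists Q : nat, beta <= ((beta - 1 + tau) * beta ^+ n)^-1 ^+ Q.
  by apply: expr_unbounded; rewrite invf_gt1.
have [T1 hT1] := expr_unbounded (((1 + tau) / tau) ^+ Q) b1.
pose kappa := Num.min (Num.min tau (F - (1 + tau)))
                      (Num.min x (M%:R / (beta - 1) - x)).
have k0 : 0 < kappa by rewrite /kappa !lt_min tau0 x0 !subr_gt0 Ftau xF.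
have [k1 k2 k3 k4] : [/\ kappa <= tau, kappa <= F - (1 + tau), kappa <= x
    & kappa <= M%:R / (beta - 1) - x].
  by split; rewrite /kappa !ge_min lexx ?orbT.
have [T0 hT0] := reach_unit_intervals M b1 k0.
(* If J * Q is about m * K, then J is the fraction m / (m + Q) of J + K. *)
pose m := (n * Q + 1)%N; pose c : R := m%:R / (m + Q)%:R.
have mQ0 : (0 : R) < (m + Q)%:R by rewrite ltr0n /m addnAC addn1.
have c1 : c <= 1 by rewrite /c ler_pdivrMr // mul1r ler_nat leq_addr.
have c0 : 0 <= c by rewrite divr_ge0 // ltW.
exists c, kappa, (T0 + T1)%N; split=> //.
- rewrite /c ltr_pdivrMr ?ltr0n // mulrAC ltr_pdivlMr // -!natrM ltr_nat /m.
  by apply: eq_leq; ring.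
- by split=> //; apply/andP; split; lra.
move=> y j k s hy jk.
(* An interval of length 1 inside the entry region of the policy for (j, k), which
   has length `|k - j| and lies on the side of j * F that faces k * F. *)
have [g [g0 gF gE]] : exists g, [/\ 0 <= g, g + 1 <= M%:R * F
    & forall u, g <= u <= g + 1 ->
        exists2 z, tau <= z <= 1 + tau & u = j%:R * F + (k%:R - j%:R) * z].
  have jM : j%:R * F <= M%:R * F by rewrite ler_pM2r // ler_nat -ltnS.
  have kM : k%:R * F <= M%:R * F by rewrite ler_pM2r // ler_nat -ltnS.
  have j0 : 0 <= j%:R * F by rewrite mulr_ge0 // ltW.
  have kk0 : 0 <= k%:R * F by rewrite mulr_ge0 // ltW.
  have [jlk|klj|/val_inj jE] := ltngtP (j : nat) k; last by rewrite jE eqxx in jk.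
    have d1 : 1 <= k%:R - j%:R :> R.
      by rewrite -natrB ?ler1n ?subn_gt0 // ltnW.
    have := ler_wpM2l (le_trans ler01 d1) (ltW Ftau).
    set d := _ - _ in d1 * => dF; have d0 : 0 < d by apply: lt_le_trans d1.
    exists (j%:R * F + d * tau); split.
    - by rewrite addr_ge0 // mulr_ge0 // ltW.
    - have kE : k%:R = j%:R + d by rewrite /d addrC subrK.
      by rewrite kE in kM; lra.
    move=> u /andP[u1 u2]; exists ((u - j%:R * F) / d).
      rewrite ler_pdivlMr // ler_pdivrMr //.
      by apply/andP; split; lra.
    by rewrite [d * _]mulrC divfK ?gt_eqF //; ring.
  have d1 : 1 <= j%:R - k%:R :> R.
    by rewrite -natrB ?ler1n ?subn_gt0 // ltnW.
  rewrite -opprB; have := ler_wpM2l (le_trans ler01 d1) (ltW Ftau).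
  set d := _ - _ in d1 * => dF; have d0 : 0 < d by apply: lt_le_trans d1.
  exists (j%:R * F - d * tau - 1); split.
  - have jE : j%:R = k%:R + d by rewrite /d addrC subrK.
    by rewrite jE; lra.
  - have : 0 <= d * tau by rewrite mulr_ge0 // ltW.
    by lra.
  move=> u /andP[u1 u2]; exists ((j%:R * F - u) / d).
    rewrite ler_pdivlMr // ler_pdivrMr //.
    by apply/andP; split; lra.
  by rewrite mulNr [d * _]mulrC divfK ?gt_eqF //; ring.
have [w1 sw1 /gE[z hz Ez]] := hT0 y g hy g0 gF.
have [w2 [sw2 cw2] [z' [hz' lez'] Ez']] :=
  pair_policy b1 tau0 rho1 (ltW btau) jk s hz.
exists (w1 ++ w2); split.
- rewrite remainder_cat Ez Ez'; move: hz' => /andP[z1 z2].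
  have jM : j%:R * F <= M%:R * F by rewrite ler_pM2r // ler_nat -ltnS.
  have kM : k%:R * F <= M%:R * F by rewrite ler_pM2r // ler_nat -ltnS.
  have j0 : 0 <= j%:R * F by rewrite mulr_ge0 // ltW.
  have kk0 : 0 <= k%:R * F by rewrite mulr_ge0 // ltW.
  have z0 : 0 <= z' by apply: le_trans z1; apply: ltW.
  have kz : kappa <= F - z' by lra.
  have Fz0 : 0 <= F - z' by apply: le_trans kz; apply: ltW.
  rewrite -/F; have [jlk|klj|/val_inj jE] := ltngtP (j : nat) k.
  + have d1 : 1 <= k%:R - j%:R :> R.
      by rewrite -natrB ?ler1n ?subn_gt0 // ltnW.
    have h1 : tau <= (k%:R - j%:R) * z' by rewrite (le_trans z1) // ler_peMl.
    have h2 : kappa <= (k%:R - j%:R) * (F - z').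
      by rewrite (le_trans kz) // ler_peMl.
    by apply/andP; split; lra.
  + have d1 : 1 <= j%:R - k%:R :> R.
      by rewrite -natrB ?ler1n ?subn_gt0 // ltnW.
    have h1 : tau <= (j%:R - k%:R) * z' by rewrite (le_trans z1) // ler_peMl.
    have h2 : kappa <= (j%:R - k%:R) * (F - z').
      by rewrite (le_trans kz) // ler_peMl.
    by apply/andP; split; lra.
  by rewrite jE eqxx in jk.
- by rewrite size_cat sw2 leq_addl addnC leq_add2l (leq_trans sw1) ?leq_addr.
- have bal : (m * count_mem k w2 <= count_mem j w2 * Q + T1)%N.
    apply: (exponent_balance b1 rho0 hQ _ hT1).
      by rewrite divr_ge0 ?addr_ge0 // ltW.
    rewrite mulrAC ler_pdivlMr // mul1r; move: hz hz' => /andP[_ hz] /andP[hz' _].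
    apply: (le_trans hz'); apply: (le_trans lez'); rewrite mulrA.
    have := mulr_ge0 (exprn_ge0 (count_mem j w2) (ltW (lt_trans ltr01 b1)))
                     (exprn_ge0 (count_mem k w2) (ltW rho0)).
    by move=> X0; rewrite -!mulrA ler_wpM2r.
  have : c * s%:R <= (count_mem j w2)%:R + T1%:R.
    rewrite /c mulrAC ler_pdivrMr // -natrD -!natrM ler_nat.
    rewrite -[in leqLHS]cw2 mulnDr; apply: leq_trans (leq_add (leqnn _) bal) _.
    rewrite mulnDl (mulnDr (count_mem j w2)) (mulnC m) addnA leq_add2l.
    by rewrite leq_pmulr // /m addnAC addn1.
  rewrite size_cat count_cat sw2 !natrD => h.
  have : c * (size w1)%:R <= T0%:R.
    by apply: le_trans (ler_piMl _ c1) _; rewrite ?ler_nat.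
  have : (0 : R) <= (count_mem j w1)%:R by [].
  by lra.
rewrite size_cat !count_cat sw2 !natrD -{1}cw2 natrD.
have : (size w1)%:R <= T0%:R :> R by rewrite ler_nat.
have : (0 : R) <= (count_mem j w1)%:R by [].
have : (0 : R) <= (count_mem k w1)%:R by [].
have : (0 : R) <= T1%:R by [].
by lra.
Qed.

(** * Following a target by greedy choices *)

(** Since u and v have the same sum, d may be replaced by its difference with
    d k.  That kills the letter k; the letter j has a nonpositive weight and
    gets its maximal target up to T, and the other letters, of nonnegative
    weight, occur at most T times in all. *)
Lemma greedy_drift (R : realType) (A : finType) (d u v : A -> R) (j k : A)
    (l c T B : R) :
  j != k -> (forall i, d j <= d i) -> (forall i, i != j -> d k <= d i) ->
  (forall i, `|d i| <= B) -> 0 <= T ->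
  (forall i, 0 <= u i) -> \sum_i u i = l ->
  c * l - T <= u j -> l - T <= u j + u k ->
  (forall i, 0 <= v i) -> \sum_i v i = l -> v j <= c * l ->
  \sum_i d i * (u i - v i) <= 4 * T * B.
Proof.
move=> jk dj dk dB T0 u0 ul uj ujk v0 vl vj.
have dBP i : - B <= d i <= B by rewrite -ler_norml.
have B0 : 0 <= B by apply: le_trans (dB j).
have -> : \sum_i d i * (u i - v i) = \sum_i (d i - d k) * (u i - v i).
  under [RHS]eq_bigr => i _ do rewrite mulrBl.
  by rewrite sumrB -mulr_sumr sumrB ul vl subrr mulr0 subr0.
rewrite (bigD1 j) //= (bigD1 k) 1?eq_sym //= subrr mul0r add0r.
have hj : (d j - d k) * (u j - v j) <= 2 * B * T.
  have := dBP j; have := dBP k; have := dj k; move=> h /andP[_ kB] /andP[jB _].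
  have h1 : 0 <= d k - d j by lra.
  have h2 : 0 <= u j - v j + T by lra.
  have h3 : d k - d j <= 2 * B by lra.
  have := mulr_ge0 h1 h2; have := ler_wpM2r T0 h3; lra.
have hrest : \sum_(i | (i != j) && (i != k)) (d i - d k) * (u i - v i)
    <= 2 * B * T.
  have hi i : (i != j) && (i != k) ->
      (d i - d k) * (u i - v i) <= 2 * B * u i.
    move=> /andP[ij _]; have := dBP i; have := dBP k; have := dk i ij.
    move=> h /andP[kB _] /andP[_ iB].
    have h1 : 0 <= d i - d k by lra.
    have h2 : d i - d k <= 2 * B by lra.
    have := mulr_ge0 h1 (v0 i); have := ler_wpM2r (u0 i) h2; lra.
  apply: (le_trans (ler_sum _ hi)); rewrite -mulr_sumr.
  rewrite ler_wpM2l ?mulr_ge0 //.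
  move: ul; rewrite (bigD1 j) //= (bigD1 k) 1?eq_sym //=; lra.
lra.
Qed.

Lemma concatenation_limit (A : Type) (x0 : A) (W : nat -> seq A) :
  (forall s, exists2 w, (0 < size w)%N & W s.+1 = W s ++ w) ->
  exists a : nat -> A, forall s, mkseq a (size (W s)) = W s.
Proof.
move=> WS.
have sW s : (s <= size (W s))%N.
  elim: s => // s IHs; have [w w0 ->] := WS s; rewrite size_cat; lia.
have Wmono s r i : (i < size (W s))%N -> nth x0 (W (s + r)%N) i = nth x0 (W s) i.
  move=> si; elim: r => [|r <-]; first by rewrite addn0.
  have [w _ Ew] := WS (s + r)%N; rewrite addnS Ew nth_cat.
  suff -> : (i < size (W (s + r)%N))%N by [].
  elim: r {w Ew} => [|r IHr]; first by rewrite addn0.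
  by rewrite addnS; have [w _ ->] := WS (s + r)%N; rewrite size_cat ltn_addr.
exists (fun i => nth x0 (W i.+1) i) => s.
apply: (@eq_from_nth _ x0); rewrite size_mkseq // => i si.
rewrite nth_mkseq //; have [is_|si'] := leqP i.+1 s.
  by rewrite -(subnKC is_) Wmono // sW.
by rewrite -(subnKC (ltnW si')) Wmono.
Qed.

(** In stage s the numerator is of order s ^ (3 / 2) and the denominator at least
    s ^ 2 / 2. *)
Lemma ratio_vanishes (R : realType) (d : nat -> R) (N : nat -> nat) (C : R) :
  0 <= C -> N 0%N = 0%N -> (forall s, (N s < N s.+1)%N) ->
  (forall s, s ^ 2 <= 2 * N s)%N ->
  (forall s m, (N s <= m <= N s.+1)%N -> d m ^+ 2 <= C * s.+1%:R ^+ 3) ->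
  (fun m => d m / m%:R) @ \oo --> (0 : R).
Proof.
move=> C0 N0 Ninc Nsq hd; apply/cvgrPdist_le => /= e e0.
pose s0 := (Num.bound (32 * C / e ^+ 2)).+1.
exists (N s0) => // m /= hm.
have [s s0s /andP[sm ms]] : exists2 s, (s0 <= s)%N & (N s <= m < N s.+1)%N.
  have hex : exists s, (N s <= m)%N by exists s0.
  have hub s : (N s <= m)%N -> (s <= m)%N.
    move=> hs; apply: leq_trans hs; elim: s => // s IHs.
    exact: leq_ltn_trans IHs (Ninc s).
  case: (ex_maxnP hex hub) => s hs smax; exists s; first exact: smax.
  by rewrite hs /= ltnNge; apply/negP => /smax; rewrite ltnn.
have s1 : (1 <= s)%N by apply: leq_trans s0s.
have m0 : (0 : R) < m%:R.
  rewrite ltr0n; have := Nsq s; have : (1 <= s ^ 2)%N by rewrite expn_gt0 s1.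
  lia.
rewrite sub0r normrN normrM normfV [`|m%:R|]ger0_norm // ler_pdivrMr //.
rewrite -(@ler_pXn2r _ 2) ?nnegrE // ?mulr_ge0 // ?(ltW e0) //.
rewrite real_normK ?num_real //.
have ms' : (N s <= m <= N s.+1)%N by rewrite sm ltnW.
apply: (le_trans (hd s m ms')).
have hs : 32 * C <= e ^+ 2 * s%:R.
  have : 32 * C / e ^+ 2 <= s%:R.
    apply: le_trans (ltW (unstable.ltr_bound _)) _.
    by rewrite ler_nat; apply: leq_trans s0s.
  by rewrite ler_pdivrMr ?exprn_gt0 // [s%:R * _]mulrC.
have S1 : 1 <= s%:R :> R by rewrite ler1n.
have hm2 : s%:R ^+ 2 <= 2 * m%:R :> R.
  by rewrite -natrX -natrM ler_nat; apply: leq_trans (Nsq s) _; rewrite leq_mul2l.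
set S : R := s%:R in hs S1 hm2 *; set X : R := m%:R in m0 hm2 *.
have S0 : 0 <= S by lra.
have hS : s.+1%:R <= 2 * S by rewrite -natr1 -/S; lra.
apply: (@le_trans _ _ (C * (2 * S) ^+ 3)).
  by rewrite ler_wpM2l // lerXn2r ?nnegrE // mulr_ge0.
have h4 : S ^+ 4 <= 4 * X ^+ 2.
  have : (S ^+ 2) ^+ 2 <= (2 * X) ^+ 2.
    by rewrite lerXn2r ?nnegrE ?mulr_ge0 ?exprn_ge0 // ltW.
  by rewrite -exprM exprMn; lra.
have := ler_wpM2r (exprn_ge0 3 S0) hs.
have := ler_wpM2l (exprn_ge0 2 (ltW e0)) h4.
rewrite !exprMn [S ^+ 4]exprS.
lra.
Qed.

Definition discrepancy {R : realType} {A : finType} (v : nat -> A -> R)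
    (w : seq A) (k : A) : R :=
  (count_mem k w)%:R - \sum_(0 <= i < size w) v i k.

Lemma discrepancy_cat (R : realType) (A : finType) (v : nat -> A -> R)
    (w1 w2 : seq A) (k : A) :
  discrepancy v (w1 ++ w2) k = discrepancy v w1 k
    + ((count_mem k w2)%:R
       - \sum_(size w1 <= i < size w1 + size w2) v i k).
Proof.
rewrite /discrepancy count_cat size_cat natrD.
by rewrite (@big_cat_nat _ _ _ (size w1)) ?leq_addr //=; ring.
Qed.

Lemma norm_count_sub_sum (R : realType) (A : finType) (v : nat -> A -> R)
    (w : seq A) (k : A) (m : nat) : (forall i, 0 <= v i k <= 1) ->
  `|(count_mem k w)%:R - \sum_(m <= i < m + size w) v i k| <= (size w)%:R.
Proof.
move=> v01.
have h1 : (count_mem k w)%:R <= (size w)%:R :> R by rewrite ler_nat count_size.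
have h2 : 0 <= \sum_(m <= i < m + size w) v i k.
  by apply: sumr_ge0 => i _; have /andP[] := v01 i.
have h3 : \sum_(m <= i < m + size w) v i k <= (size w)%:R.
  apply: (@le_trans _ _ (\sum_(m <= i < m + size w) 1)).
    by apply: ler_sum => i _; have /andP[] := v01 i.
  by rewrite big_const_nat iter_addr_0 addKn.
have h4 : (0 : R) <= (count_mem k w)%:R by [].
by rewrite ler_norml; apply/andP; split; lra.
Qed.

Lemma sum_count_mem (A : finType) (w : seq A) :
  (\sum_k count_mem k w = size w)%N.
Proof.
elim: w => [|x w IHw]; first by rewrite big1.
rewrite /= big_split /= IHw (bigD1 x) //= eqxx big1 // => i.
by rewrite eq_sym => /negbTE ->.
Qed.

Lemma two_smallest (R : realType) (A : finType) (d : A -> R) :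
  (1 < #|A|)%N ->
  exists j, exists k, [/\ j != k, forall i, d j <= d i
                         & forall i, i != j -> d k <= d i].
Proof.
case/card_gt1P => a [b [_ _ ab]].
case: (@arg_minP _ _ A a xpredT d) => // j _ hj.
have [c cj] : exists c, c != j.
  case: (eqVneq a j) ab => [-> jb|aj _]; last by exists a.
  by exists b; rewrite eq_sym.
case: (@arg_minP _ _ A c (fun i => i != j) d) => // k kj hk.
by exists j, k; split=> // [|i]; [rewrite eq_sym | apply: hj].
Qed.

(** An approachability theorem for words: if every pair of letters can be favoured
    at will up to bounded errors, then every target sequence of probability
    vectors bounded by c is followed with sublinear error.  Stages of growing
    length are needed because each one costs an error T: with stages of bounded
    length these errors would have a positive frequency. *)
Lemma steered_discrepancy (R : realType) (A : finType) (good : seq A -> Prop)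
    (c : R) (T : nat) (v : nat -> A -> R) :
  (1 < #|A|)%N -> c <= 1 ->
  (forall i a, 0 <= v i a <= c) -> (forall i, \sum_a v i a = 1) ->
  good [::] ->
  (forall W j k s, good W -> j != k -> exists w : seq A,
     [/\ good (W ++ w), (s <= size w <= s + T)%N,
         c * (size w)%:R - T%:R <= (count_mem j w)%:R
       & (size w)%:R - T%:R <= (count_mem j w)%:R + (count_mem k w)%:R :> R]) ->
  exists a : nat -> A,
    (forall n, exists2 N, (n <= N)%N & good (mkseq a N)) /\
    forall k, (fun N => discrepancy v (mkseq a N) k / N%:R) @ \oo --> (0 : R).
Proof.
move=> A1 c1 vc v1 good0 steer.
have v01 k i : 0 <= v i k <= 1.
  by have /andP[-> /le_trans->] := vc i k.
pose T1 : R := T%:R + 1.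
have T10 : 0 <= T1 by rewrite /T1 addr_ge0.
pose C : R := 8 * T1 ^+ 2 + #|A|%:R * T1 ^+ 2.
have C0 : 0 <= C by rewrite addr_ge0 // mulr_ge0 // exprn_ge0.
pose inv s W := [/\ good W, (s ^ 2 <= 2 * size W)%N,
  (size W)%:R <= T1 * s%:R ^+ 2
  & \sum_k discrepancy v W k ^+ 2 <= C * s%:R ^+ 3].
pose ext (s : nat) (W W' : seq A) :=
  exists2 w, W' = W ++ w & (s.+1 <= size w <= s.+1 + T)%N.
have step s W : inv s W -> exists W', ext s W W' /\ inv s.+1 W'.
  case=> gW Wl Wu WE.
  have [j [k [jk dj dk]]] := two_smallest (discrepancy v W) A1.
  have [w [gw /andP[sw1 sw2] hj hjk]] := steer W j k s.+1 gW jk.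
  exists (W ++ w); split; first by exists w; rewrite ?sw1.
  have lw : (size w)%:R <= T1 * s.+1%:R.
    apply: (@le_trans _ _ (s.+1 + T)%:R); first by rewrite ler_nat.
    rewrite natrD /T1 mulrDl mul1r addrC lerD2r ler_peMr //.
    by rewrite ler1n.
  have sE : s.+1%:R = s%:R + 1 :> R by rewrite natr1.
  have s0 : (0 : R) <= s%:R by [].
  split=> //.
  - rewrite size_cat; move: Wl sw1; rewrite -!mulnn; clear; lia.
  - rewrite size_cat natrD sE; rewrite sE in lw.
    apply: le_trans (lerD Wu lw) _; rewrite -mulrDr ler_wpM2l //.
    by rewrite expr2; lra.
  pose dv i : R := (count_mem i w)%:R
                   - \sum_(size W <= l < size W + size w) v l i.
  have -> : \sum_i discrepancy v (W ++ w) i ^+ 2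
      = \sum_i discrepancy v W i ^+ 2 + 2 * \sum_i discrepancy v W i * dv i
        + \sum_i dv i ^+ 2.
    rewrite mulr_sumr -!big_split /=; apply: eq_bigr => i _.
    by rewrite discrepancy_cat -/(dv i); ring.
  have drift : \sum_i discrepancy v W i * dv i <= 4 * T%:R * (size W)%:R.
    apply: (@greedy_drift _ _ _ _ _ j k (size w)%:R c) => //.
    - move=> i; have := norm_count_sub_sum W 0 (v01 i).
      by rewrite add0n.
    - by rewrite -natr_sum sum_count_mem.
    - by move=> i; apply: sumr_ge0 => l _; have /andP[] := v01 i l.
    - rewrite exchange_big /=; under eq_bigr => l _ do rewrite v1.
      by rewrite big_const_nat iter_addr_0 addKn.
    - apply: (@le_trans _ _ (\sum_(size W <= l < size W + size w) c)).
        by apply: ler_sum => l _; have /andP[] := vc l j.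
      by rewrite big_const_nat iter_addr_0 addKn mulr_natr.
  have quad : \sum_i dv i ^+ 2 <= #|A|%:R * (T1 * s.+1%:R) ^+ 2.
    rewrite mulr_natl -sumr_const; apply: ler_sum => i _.
    rewrite -real_normK ?num_real // lerXn2r ?nnegrE //.
      by rewrite mulr_ge0.
    exact: le_trans (norm_count_sub_sum _ _ (v01 i)) lw.
  have drift2 : 2 * (4 * T%:R * (size W)%:R) <= 8 * T1 ^+ 2 * s.+1%:R ^+ 2.
    have h1 : T%:R * (size W)%:R <= T1 * (T1 * s%:R ^+ 2).
      by apply: ler_pM => //; rewrite /T1 lerDl.
    have h2 : T1 * (T1 * s%:R ^+ 2) <= T1 * (T1 * s.+1%:R ^+ 2).
      by rewrite !ler_wpM2l // lerXn2r ?nnegrE // ler_nat.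
    lra.
  (* The increment at stage s is at most C * (s + 1) ^ 2, which the growth of the
     cube absorbs. *)
  have cube : s%:R ^+ 3 + s.+1%:R ^+ 2 <= s.+1%:R ^+ 3 :> R.
    rewrite sE; have := sqr_ge0 (s%:R : R); lra.
  apply: le_trans (ler_wpM2l C0 cube).
  have CE : C * s.+1%:R ^+ 2
      = 8 * T1 ^+ 2 * s.+1%:R ^+ 2 + #|A|%:R * (T1 * s.+1%:R) ^+ 2.
    by rewrite /C exprMn; ring.
  rewrite mulrDr CE; move: WE drift drift2 quad; clear; lra.
have /choice[f hf] : forall sW : nat * seq A, exists W',
    inv sW.1 sW.2 -> ext sW.1 sW.2 W' /\ inv sW.1.+1 W'.
  move=> [s W]; have [/step[W' ?]|?] := pselect (inv s W); first by exists W'.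
  by exists W.
pose W := fix W s := if s is s'.+1 then f (s', W s') else [::].
have invW s : inv s (W s).
  elim: s => [|s IHs] /=; last by have [] := hf (s, W s) IHs.
  split=> //; first by rewrite expr0n mulr0.
  rewrite big1 ?expr0n ?mulr0 // => k _.
  by rewrite /discrepancy /= big_geq // subrr expr0n.
have WS s : ext s (W s) (W s.+1) by have [] := hf (s, W s) (invW s).
have [a0 _] : exists x : A, true.
  by have /card_gt0P[x _] := ltnW A1; exists x.
have [|a aW] := concatenation_limit a0 (W := W).
  move=> s; have [w -> /andP[w1 _]] := WS s.
  by exists w => //; apply: leq_trans w1.
have Nlt s : (size (W s) < size (W s.+1))%N.
  by have [w -> /andP[w1 _]] := WS s; rewrite size_cat; lia.
have Nge s : (s <= size (W s))%N.
  by elim: s => // s IHs; apply: leq_ltn_trans IHs (Nlt s).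
exists a; split.
  by move=> n; exists (size (W n)) => //; rewrite aW; have [] := invW n.
move=> k.
apply: (@ratio_vanishes _ _ (fun s => size (W s)) (2 * C + 2 * T1 ^+ 2)).
- by rewrite addr_ge0 ?mulr_ge0 ?exprn_ge0.
- by [].
- by [].
- by move=> s; have [] := invW s.
move=> s m /andP[sm ms].
have s0 : (0 : R) <= s%:R by [].
have sE : s.+1%:R = s%:R + 1 :> R by rewrite natr1.
(* Inside a stage, the discrepancy changes by at most the length of the stage. *)
pose u := map a (iota (size (W s)) (m - size (W s))).
have -> : mkseq a m = W s ++ u.
  by rewrite -{1}(aW s) -map_cat -iotaD subnKC.
rewrite discrepancy_cat; set y := _ - _.
have hy : `|y| <= T1 * s.+1%:R.
  apply: le_trans (norm_count_sub_sum _ _ (v01 k)) _.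
  apply: (@le_trans _ _ (s.+1 + T)%:R).
    rewrite ler_nat size_map size_iota.
    by have [w Ew /andP[_ w2]] := WS s; rewrite Ew size_cat in ms; lia.
  rewrite natrD /T1 mulrDl mul1r addrC lerD2r ler_peMr //.
  by rewrite ler1n.
have y2 : y ^+ 2 <= T1 ^+ 2 * s.+1%:R ^+ 2.
  rewrite -exprMn -real_normK ?num_real // lerXn2r ?nnegrE //.
  by rewrite mulr_ge0.
have d2 : discrepancy v (W s) k ^+ 2 <= C * s%:R ^+ 3.
  have [_ _ _] := invW s; apply: le_trans.
  rewrite (bigD1 k) //= lerDl; apply: sumr_ge0 => i _; exact: sqr_ge0.
have c1' : C * s%:R ^+ 3 <= C * s.+1%:R ^+ 3.
  by rewrite ler_wpM2l // lerXn2r ?nnegrE // ler_nat.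
have c2' : T1 ^+ 2 * s.+1%:R ^+ 2 <= T1 ^+ 2 * s.+1%:R ^+ 3.
  by rewrite ler_wpM2l ?exprn_ge0 // ler_weXn2l // ler1n.
have := sqr_ge0 (discrepancy v (W s) k - y); lra.
Qed.

(** * Frequencies that do not exist *)

Lemma freq_upto_count (R : realType) (M : nat) (a : digit_seq M)
    (k : 'I_M.+1) (N : nat) :
  freq_upto R a k N = (count_mem k (mkseq a N))%:R / N%:R.
Proof.
rewrite /freq_upto; congr (_%:R / _).
by rewrite -sum1_card -sum1_count big_map -[N in iota 0 N]subn0 big_mkord.
Qed.

Lemma cvg_eq_pos (R : realType) (f g : nat -> R) (l : R) :
  (forall N, (0 < N)%N -> f N = g N) -> f @ \oo --> l -> g @ \oo --> l.
Proof.
move=> fg; apply: cvg_trans; apply: near_eq_cvg.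
by exists 1%N => // N /=; apply: fg.
Qed.

(** The averages r m at times 2 ^ m satisfy r (m + 1) = (r m + e) / 2 with e
    alternately 0 and 1, so a limit l would be both l / 2 and (l + 1) / 2. *)
Lemma dyadic_blocks_no_average (R : realType) :
  ~ exists l : R,
    (fun N => (\sum_(0 <= i < N) (odd (trunc_log 2 i))%:R) / N%:R) @ \oo --> l.
Proof.
case=> l /cvgrPdist_lt /(_ (1 / 8)) []; first by lra.
move=> m0 _ hl.
pose r m : R :=
  (\sum_(0 <= i < 2 ^ m) (odd (trunc_log 2 i))%:R) / (2 ^ m)%:R.
have hr m : (m0 <= m)%N -> `|l - r m| < 1 / 8.
  by move=> ?; apply: hl => /=; apply: leq_trans (ltnW (ltn_expl m _)).
have rS m : r m.+1 = r m / 2 + (odd m)%:R / 2.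
  rewrite /r (@big_cat_nat _ _ _ (2 ^ m)) //=; last by rewrite leq_exp2l.
  have -> : \sum_(2 ^ m <= i < 2 ^ m.+1) (odd (trunc_log 2 i))%:R
      = (odd m)%:R * (2 ^ m)%:R :> R.
    rewrite (@eq_big_nat _ _ _ _ _ _ (fun=> (odd m)%:R)); last first.
      by move=> i hi; rewrite (@trunc_log_eq 2 m i).
    by rewrite big_const_nat iter_addr_0 expnS mul2n -addnn addnK mulr_natr.
  have : (2 ^ m)%:R != 0 :> R by rewrite pnatr_eq0 expn_eq0.
  by rewrite expnS natrM => ?; field.
have m02 : (m0 <= m0.*2)%N by rewrite -addnn leq_addr.
have := hr _ m02; have := hr _ (leqW m02); have := hr _ (leqW (leqW m02)).
rewrite !rS /= odd_double /= !ltr_norml; move: (r _) => x.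
move=> /andP[? ?] /andP[? ?] /andP[? ?]; lra.
Qed.

(** The mass q left by p is spread evenly over D and perturbed in the direction h,
    which has zero sum and no zero entry, so that every letter of D oscillates. *)
Lemma oscillating_target (R : realType) (A : finType) (D : {set A}) (p : A -> R)
    (c : R) :
  (2 <= #|D|)%N -> 1 / 2 < c -> c <= 1 ->
  (forall k, k \in ~: D -> 0 <= p k <= c) -> \sum_(k in ~: D) p k < 1 ->
  exists v : nat -> A -> R,
  [/\ forall i k, 0 <= v i k <= c, forall i, \sum_k v i k = 1,
      forall i k, k \in ~: D -> v i k = p k
    & forall k, k \in D -> exists al be : R, be != 0 /\
        forall i, v i k = al + be * (odd (trunc_log 2 i))%:R].
Proof.
move=> D2 c2 c1 pc psum.
pose q := 1 - \sum_(k in ~: D) p k; pose r : R := #|D|%:R.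
have r2 : 2 <= r by rewrite ler_nat.
have r0 : 0 < r by apply: lt_le_trans r2.
have q0 : 0 < q by rewrite subr_gt0.
have q1 : q <= 1.
  rewrite /q gerBl; apply: sumr_ge0 => k /pc; by case/andP.
have [d0 d0D] : exists d0, d0 \in D by apply/card_gt0P; apply: leq_trans D2.
(* Bounded by q / r for positivity, and by (c - 1/2) / r because an entry
   q / r <= 1/2 is raised by at most r * del. *)
pose del := Num.min q (c - 1 / 2) / r.
have del0 : 0 < del by rewrite divr_gt0 // lt_min q0 subr_gt0.
have delq : del <= q / r by rewrite ler_pM2r ?invr_gt0 // ge_min lexx.
have delc : r * del <= c - 1 / 2.
  by rewrite mulrC divfK ?gt_eqF // ge_min lexx orbT.
have qr2 : q / r <= 1 / 2 by rewrite ler_pdivrMr //; lra.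
pose h k : R := r * (k == d0)%:R - 1.
pose sg i : R := (odd (trunc_log 2 i))%:R.
pose v i k := if k \in D then q / r + del * h k * sg i else p k.
exists v; split.
- move=> i k; rewrite /v; have [kD|kD] := boolP (k \in D); last first.
    by apply: pc; rewrite inE.
  rewrite /h /sg; have rd := ltW (mulr_gt0 r0 del0).
  by case: (k == d0); case: odd => /=; apply/andP; split; lra.
- move=> i; rewrite (bigID (mem D)) /=.
  rewrite (eq_bigr (fun k => q / r + del * sg i * h k)); last first.
    by move=> k kD; rewrite /v kD mulrAC.
  rewrite big_split /= sumr_const -mulr_sumr.
  have -> : \sum_(k in D) h k = 0.
    rewrite /h sumrB -mulr_sumr sumr_const (bigD1 d0) //= eqxx big1 ?addr0.
      by rewrite mulr1 subrr.
    by move=> k /andP[_ /negbTE->].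
  rewrite mulr0 addr0 -mulr_natr -/r divfK ?gt_eqF //.
  rewrite (eq_bigr p); last by move=> k kD; rewrite /v (negbTE kD).
  rewrite /q (eq_bigl (fun k => k \in ~: D)) ?subrK //.
  by move=> k; rewrite inE.
- by move=> i k; rewrite inE /v => /negbTE->.
move=> k kD; exists (q / r), (del * h k); split; last by move=> i; rewrite /v kD.
apply: mulf_neq0; first by rewrite gt_eqF.
rewrite /h; case: (k == d0) => /=.
  by rewrite mulr1 gt_eqF //; lra.
by rewrite mulr0 sub0r oppr_eq0 oner_eq0.
Qed.

Theorem theorem1p4 (R : realType) (M n : nat) (beta : R)
    (D : {set 'I_M.+1}) (p : 'I_M.+1 -> R) :
  (2 <= M)%N -> (1 <= n)%N ->
  1 < beta -> beta < betan R n ->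
  (2 <= #|D|)%N ->
  (forall k, k \in ~: D -> 0 <= p k <= n%:R / n.+1%:R) ->
  \sum_(k in ~: D) p k < 1 ->
  forall x : R, 0 < x < M%:R / (beta - 1) ->
  exists a : digit_seq M,
    [/\ Sigma beta x a,
        forall k, k \in D -> ~ freq_exists R a k
      & forall k, k \in ~: D -> freq_is a k (p k)].
Proof.
move=> _ n1 b1 bn D2 pn psum x hx.
have [c [kappa [T [nc c1 [hxk k0] steer]]]] :=
  steering b1 (betan_slack n1 b1 bn) hx.
have c2 : 1 / 2 < c.
  apply: le_lt_trans nc; rewrite ler_pdivlMr ?ltr0n // mulrAC ler_pdivrMr //.
  by rewrite mul1r -natrM ler_nat muln2 -addnn -addn1 leq_add2l.
have pc k : k \in ~: D -> 0 <= p k <= c.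
  by move=> /pn/andP[-> /le_trans->] //; apply: ltW.
have [v [vc v1 vp vD]] := oscillating_target D2 c2 c1 pc psum.
pose good (W : seq 'I_M.+1) :=
  kappa <= remainder beta x W <= M%:R / (beta - 1) - kappa.
have A1 : (1 < #|'I_M.+1|)%N by apply: leq_trans D2 (max_card _).
have [|a [agood adisc]] := 
    steered_discrepancy (good := good) (T := T) A1 c1 vc v1 hxk.
  move=> W j k s gW jk; have [w [? ? ? ?]] := steer _ j k s gW jk.
  by exists w; rewrite /good remainder_cat.
have fq k (l : R) : freq_upto R a k @ \oo --> l ->
    (fun N => (\sum_(0 <= i < N) v i k) / N%:R) @ \oo --> l.
  move=> hl; have hB : (fun N => freq_upto R a k N
      - discrepancy v (mkseq a N) k / N%:R) @ \oo --> l.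
    by rewrite -[l]subr0; apply: cvgB.
  apply: cvg_eq_pos hB => N _.
  by rewrite freq_upto_count /discrepancy size_mkseq mulrBl /=; ring.
exists a; split.
- apply: (Sigma_of_bounded_remainders (B := M%:R / (beta - 1)) b1) => N.
  have [N' leN /andP[g1 g2]] := agood N; exists N' => //.
  by apply/andP; split; lra.
- move=> k kD [l /fq hl]; have [al [be [be0 vE]]] := vD k kD.
  apply: (@dyadic_blocks_no_average R); exists ((l - al) / be).
  have hM : (fun N => ((\sum_(0 <= i < N) v i k) / N%:R - al) / be)
      @ \oo --> (l - al) / be.
    by apply: cvgM; [apply: cvgB => //|]; apply: cvg_cst.
  apply: cvg_eq_pos hM => N N0.
  under eq_bigr => i _ do rewrite vE.
  have NN0 : N%:R != 0 :> R by rewrite pnatr_eq0 -lt0n.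
  rewrite big_split /= -mulr_sumr big_const_nat iter_addr_0 subn0 -mulr_natr.
  by field; rewrite be0 NN0.
move=> k kD; rewrite /freq_is.
have hD : (fun N => discrepancy v (mkseq a N) k / N%:R + p k) @ \oo --> p k.
  by rewrite -[X in _ --> X]add0r; apply: cvgD => //; apply: cvg_cst.
apply: cvg_eq_pos hD => N N0.
rewrite freq_upto_count /discrepancy size_mkseq.
under eq_bigr => i _ do rewrite vp //.
have : N%:R != 0 :> R by rewrite pnatr_eq0 -lt0n.
by rewrite big_const_nat iter_addr_0 subn0 -[p k *+ N]mulr_natr => ?; field.
Qed.
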